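(* For any probability $p=p(n)\in[0,1]$, with high probability (i.e. with probability tending to $1$ as $n\to\infty$) the Erdős–Rényi random graph $G(n,p)$ has a separating path system of size at most $48n$.
   Context: $G(n,p)$ is the random graph on $n$ vertices in which each pair of vertices is joined by an edge independently with probability $p$. For a graph $G$, a family $\mathcal{P}$ of subsets of $E(G)$ is a separating path system of $G$ if every member of $\mathcal{P}$ is (the edge set of) a path in $G$, and for every pair of distinct edges $e,e'\in E(G)$ there is some $P\in\mathcal{P}$ containing exactly one of $e,e'$. *)

(* Defs.v *)
From mathcomp Require Import all_boot all_order all_algebra.
From mathcomp Require Import boolp.
From mathcomp Require Import reals.
Set Implicit Arguments. Unset Strict Implicit. Unset Printing Implicit Defensive.
Import Order.TTheory GRing.Theory Num.Theory.
Local Open Scope ring_scope.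

(* Vertices of G(n,p): 'I_n.  Potential edges: 2-element subsets of 'I_n.
   A graph on 'I_n is a set of 2-element subsets (its edge set). *)
Definition pairs (n : nat) : {set {set 'I_n}} := [set e : {set 'I_n} | #|e| == 2%N].

Definition is_graph (n : nat) (G : {set {set 'I_n}}) : bool := G \subset pairs n.

Definition walk_edges (n : nat) (s : seq 'I_n) : {set {set 'I_n}} :=
  [set e in [seq [set xy.1; xy.2] | xy <- zip s (behead s)]].

Definition is_path_in (n : nat) (G P : {set {set 'I_n}}) : Prop :=
  exists s : seq 'I_n, [/\ uniq s, P = walk_edges s & P \subset G].

Definition separating_path_system (n : nat) (G : {set {set 'I_n}})
    (F : {set {set {set 'I_n}}}) : Prop :=
  (forall P, P \in F -> is_path_in G P) /\
  (forall e e', e \in G -> e' \in G -> e != e' ->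
     exists2 P, P \in F & (e \in P) != (e' \in P)).

Definition has_sps_of_size_le (n : nat) (G : {set {set 'I_n}}) (k : nat) : Prop :=
  exists F, separating_path_system G F /\ (#|F| <= k)%N.

(* Law of G(n,p): each of the 'C(n,2) pairs is an edge independently w.p. p. *)
Definition gnp_weight (R : realType) (n : nat) (p : R) (G : {set {set 'I_n}}) : R :=
  \prod_(e in pairs n) (if e \in G then p else 1 - p).

Definition gnp_prob (R : realType) (n : nat) (p : R)
    (Q : {set {set 'I_n}} -> Prop) : R :=
  \sum_(G : {set {set 'I_n}} | is_graph G && `[< Q G >]) gnp_weight p G.

(* Main.v *)
Require Import Defs.
From mathcomp Require Import all_boot all_order all_algebra.
From mathcomp Require Import boolp reals zify.
Set Implicit Arguments.
Unset Strict Implicit.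
Unset Printing Implicit Defensive.
Import Order.TTheory GRing.Theory Num.Theory.

(* Every graph, random or not, has a separating path system of size at most [18 n]
   (an argument of Bonamy, Botler, Dross, Naia and Skokan).  Take a longest path [P] and
   let [S] be the set of end vertices reached from [P] by Posa rotations fixing the other
   end.  All neighbours of [S] lie in [T], the union of [S] and its neighbours along [P],
   so [#|T| <= 3 #|S|].  Rank [T] along [P].  For [w = 1, 2], the edges [ab] meeting [S]
   and off [P] that have a given value of [rank a + w * rank b] are nested chords of [P],
   and a zigzag through them and pieces of [P] is a path.  These at most [15 #|S|] paths
   identify the chords among themselves; [P] separates them from its own edges, and the
   at most [2 #|S|] edges of [P] meeting [S] are taken as one-edge paths.  Delete [S] and
   repeat. *)

Local Open Scope nat_scope.

(** * Edge sets of walks *)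

Lemma walk_edgesP {n} (s : seq 'I_n) (e : {set 'I_n}) :
  reflect (exists l a b r, s = l ++ a :: b :: r /\ e = [set a; b])
          (e \in walk_edges s).
Proof.
apply: (iffP idP).
  rewrite inE; elim: s => [|a [|b s] IH] //=.
  rewrite in_cons => /orP [/eqP ->|/IH [l [c [d [r [-> ->]]]]]].
    by exists [::], a, b, s.
  by exists (a :: l), c, d, r.
move=> [l [a [b [r [-> ->]]]]]; rewrite inE.
elim: l => [|c l IH] /=; first by rewrite mem_head.
by case: l IH => [|d l] /= IH; rewrite in_cons IH orbT.
Qed.

Lemma walk_edges_cons2 {n} (a b : 'I_n) s :
  walk_edges [:: a, b & s] = [set a; b] |: walk_edges (b :: s).
Proof. by apply/setP => e; rewrite !inE. Qed.

Lemma walk_edges_catr {n} (l s : seq 'I_n) : walk_edges s \subset walk_edges (l ++ s).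
Proof.
apply/subsetP => e /walk_edgesP [l' [a [b [r [-> ->]]]]].
by apply/walk_edgesP; exists (l ++ l'), a, b, r; rewrite -catA.
Qed.

Lemma walk_edges_catl {n} (s r : seq 'I_n) : walk_edges s \subset walk_edges (s ++ r).
Proof.
apply/subsetP => e /walk_edgesP [l' [a [b [r' [-> ->]]]]].
by apply/walk_edgesP; exists l', a, b, (r' ++ r); rewrite -catA.
Qed.

Lemma walk_edges_rev {n} (s : seq 'I_n) : walk_edges (rev s) = walk_edges s.
Proof.
have sub t : walk_edges t \subset walk_edges (rev t).
  apply/subsetP => e /walk_edgesP [l [a [b [r [-> ->]]]]].
  apply/walk_edgesP; exists (rev r), b, a, (rev l).
  by rewrite rev_cat !rev_cons -!cats1 -!catA /= setUC.
by apply/eqP; rewrite eqEsubset sub andbT -{2}(revK s) sub.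
Qed.

Lemma walk_edges_cat {n} l (a : 'I_n) s :
  walk_edges (l ++ a :: s) = walk_edges (rcons l a) :|: walk_edges (a :: s).
Proof.
elim: l => [|c [|d l] IH] /=.
- by apply/setP => e; rewrite !inE.
- by rewrite !walk_edges_cons2; apply/setP => e; rewrite !inE orbF.
- by rewrite !walk_edges_cons2 IH setUA.
Qed.

Lemma walk_edges_index {n} s (a b : 'I_n) : uniq s -> [set a; b] \in walk_edges s ->
  [/\ a \in s, b \in s & (index b s == (index a s).+1)
                         || (index a s == (index b s).+1)].
Proof.
move=> us /walk_edgesP [l [c [d [r [defs /setP eab]]]]].
have cs : c \in s by rewrite defs mem_cat mem_head orbT.
have ds : d \in s by rewrite defs mem_cat !in_cons eqxx !orbT.
have idx : index d s = (index c s).+1.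
  move: us; rewrite defs cat_uniq /= !in_cons !negb_or.
  move=> /and3P [_ /and3P [/negPf cl /negPf dl _] /andP [/andP [/negPf cd _] _]].
  by rewrite !index_cat cl dl /= !eqxx cd addn0 addn1.
have /negPf ncd : c != d by apply/eqP => ecd; move: idx; rewrite ecd; lia.
have := eab c; have := eab d; rewrite !inE !eqxx orbT /=.
case/orP=> /eqP ed /orP [] /eqP ec; rewrite -?ed -?ec ?cs ?ds ?idx ?eqxx ?orbT //.
all: by rewrite ed ec eqxx in ncd.
Qed.

(** * Nested chords and zigzag paths *)

(* The nested chords [(a_1, b_1), ..., (a_k, b_k)] occur along [t] as
   [a_1 ... a_k ... b_k ... b_1]; after jumping from [a_1] to [b_1], the rest of the
   path lives in the reversed segment strictly between them, where the remaining
   chords are nested again with their ends swapped. *)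
Lemma zigzag_path {n} (c : seq ('I_n * 'I_n)) x t :
  uniq (x :: t) -> subseq (map fst c ++ rev (map snd c)) (x :: t) ->
  exists q, [/\ uniq (x :: q), {subset q <= t},
    forall u, u \in c -> [set u.1; u.2] \in walk_edges (x :: q) &
    forall e, e \in walk_edges (x :: q) -> e \in walk_edges (x :: t) \/
      exists2 u, u \in c & e = [set u.1; u.2]].
Proof.
(* Induction is on the length of [t], not on the chords: when [x] is not the next chord end, the
   path merely advances by one vertex. *)
have [k] := ubnP (size t); elim: k c x t => // k IH [|[a b] c] x t ltk uxt.
  by move=> _; exists [::]; split=> //= e; rewrite inE.
rewrite /= rev_cons -rcons_cat; case: (eqVneq a x) uxt => [<-|nax] uxt; last first.
  case: t ltk uxt => // y t ltk uxt sub.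
  have {IH} := IH ((a, b) :: c) y t; case=> //.
  - by case/andP: uxt.
  - by rewrite /= rev_cons -rcons_cat.
  move=> q [uq sq cq wq]; exists (y :: q); split.
  - rewrite uq andbT; case/andP: uxt => nx _.
    apply: contra nx; rewrite !in_cons => /orP [->//|/sq ->]; exact: orbT.
  - by move=> z; rewrite !in_cons => /orP [->//|/sq ->]; rewrite orbT.
  - by move=> u /cq; rewrite walk_edges_cons2 in_setU => ->; rewrite orbT.
  - move=> e; rewrite !walk_edges_cons2 !in_setU => /orP [->|/wq [->|]]; rewrite ?orbT; auto.
rewrite -cats1 => sub.
have bt : b \in t by apply: (mem_subseq sub); rewrite mem_cat mem_head orbT.
case/splitPr: bt ltk uxt sub => t2 t3 ltk uxt.
(* As [b] occurs only once, the ends of the remaining chords all lie in [t2], strictly between [a]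
   and [b]. *)
rewrite uniq_subseq_pivot; last by case/andP: uxt.
case/andP=> sub _.
have [|||q [uq sq cq wq]] := IH [seq (u.2, u.1) | u <- c] b (rev t2).
- by move: ltk; rewrite size_cat size_rev /=; lia.
- move: uxt; rewrite /= mem_rev rev_uniq cat_uniq /= negb_or.
  by move=> /andP [_ /and3P [-> /andP [-> _] _]].
- rewrite -!map_comp; apply: subseq_trans (subseq_cons _ _).
  by rewrite -[_ ++ _]revK subseq_rev rev_cat revK.
have nabt : a \notin t2 ++ b :: t3 by case/andP: uxt.
exists (b :: q); split.
- rewrite uq andbT; apply: contra nabt.
  rewrite in_cons mem_cat in_cons => /orP [->|/sq]; first by rewrite orbT.
  by rewrite mem_rev => ->.
- move=> z; rewrite in_cons mem_cat in_cons => /orP [->|/sq]; first by rewrite orbT.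
  by rewrite mem_rev => ->.
- move=> u; rewrite in_cons walk_edges_cons2 in_setU in_set1 => /orP [/eqP ->|uc].
    by rewrite eqxx.
  have /cq /= : (u.2, u.1) \in [seq (u.2, u.1) | u <- c] by apply: map_f.
  by rewrite setUC => ->; rewrite orbT.
- move=> e; rewrite walk_edges_cons2 in_setU in_set1 => /orP [/eqP ->|/wq [ein|]].
  + by right; exists (a, b); rewrite ?mem_head.
  (* A segment walked backwards has the same edges, so these are still edges of the original
     path. *)
  + left; move: ein; rewrite -walk_edges_rev rev_cons revK -cats1 => ein.
    apply: (subsetP (walk_edges_catr [:: a] _)).
    by rewrite -cat1s catA; apply: (subsetP (walk_edges_catl _ t3)).
  + move=> [_ /mapP [u uc ->] ->]; right; exists u; first by rewrite in_cons uc orbT.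
    exact: setUC.
Qed.

(** Filtering [s] by membership in [l] gives a list with the same elements, also increasing in
    index; two lists sorted by a strict order with the same elements coincide. *)
Lemma subseq_index_sorted {n} (s l : seq 'I_n) :
  uniq s -> {subset l <= s} -> pairwise (fun a b => index a s < index b s) l ->
  subseq l s.
Proof.
move=> us ls srt; set lt := fun _ _ => _ in srt.
have lt_tr : transitive lt by move=> b a c; apply: ltn_trans.
have lt_irr : irreflexive lt by move=> a; apply: ltnn.
have s_srt : sorted lt s.
  case def_s: (s) => [|x0 t] //; rewrite -def_s; apply/(sortedP x0) => i lt_i.
  by rewrite /lt !index_uniq // ltnW.
rewrite (irr_sorted_eq lt_tr lt_irr (s1 := l) (s2 := [seq a <- s | a \in l])) ?filter_subseq //.
- exact: pairwise_sorted.
- exact: sorted_filter.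
- by move=> a; rewrite mem_filter; case: (boolP (a \in l)) => // /ls.
Qed.

(** Sorted by left end, the chords have decreasing right ends, so the left ends followed by the
    reversed right ends occur in this order along [s], as [zigzag_path] demands. *)
Lemma nested_chords_path {n} (s : seq 'I_n) (C : {set 'I_n * 'I_n}) :
  uniq s ->
  (forall u, u \in C -> [/\ u.1 \in s, u.2 \in s & index u.1 s < index u.2 s]) ->
  (forall u v, u \in C -> v \in C -> u != v -> index u.1 s <= index v.1 s ->
     index u.1 s < index v.1 s /\ index v.2 s < index u.2 s) ->
  exists q, [/\ uniq q,
    forall u, u \in C -> [set u.1; u.2] \in walk_edges q &
    forall e, e \in walk_edges q -> e \in walk_edges s \/
      exists2 u, u \in C & e = [set u.1; u.2]].
Proof.
move=> us Cs nest.
pose le := relpre (fun u : 'I_n * 'I_n => index u.1 s) leq.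
pose c := sort le (enum C).
have mc u : (u \in c) = (u \in C) by rewrite mem_sort mem_enum.
have le_tr : transitive le by move=> v u t; apply: leq_trans.
have : pairwise (fun u v => (index u.1 s < index v.1 s) && (index v.2 s < index u.2 s)) c.
  have : pairwise [rel u v | le u v && (u != v)] c.
    rewrite pairwise_relI -sorted_pairwise // sort_sorted; last by move=> u v; apply: leq_total.
    by rewrite -uniq_pairwise sort_uniq enum_uniq.
  apply: (@sub_in_pairwise _ [in c]); last by apply/allP.
  by move=> u v; rewrite !mc => uC vC /= /andP [luv nuv]; apply/andP; apply: nest.
move=> pc.
have sub : subseq (map fst c ++ rev (map snd c)) s.
  apply: subseq_index_sorted => //.
    move=> a; rewrite mem_cat mem_rev => /orP [] /mapP [u]; rewrite mc => /Cs [] ? ? _ -> //.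
  rewrite pairwise_cat; apply/and3P; split.
  (* Every left end precedes every right end, even that of another chord: of two nested chords, the
     inner one lies between the ends of the outer one. *)
  - apply/allrelP => a b /mapP [u uc ->]; rewrite mem_rev => /mapP [v vc ->].
    move: uc vc; rewrite !mc => uC vC; have [_ _ lu] := Cs _ uC; have [_ _ lv] := Cs _ vC.
    have [->//|nuv] := eqVneq u v.
    have [luv|lvu] := leqP (index u.1 s) (index v.1 s).
      by case: (nest _ _ uC vC nuv luv) => luv' _; apply: ltn_trans lv.
    rewrite eq_sym in nuv; case: (nest _ _ vC uC nuv (ltnW lvu)) => _; exact: ltn_trans.
  - by rewrite pairwise_map; apply: sub_pairwise pc => u v /andP [].
  - have : pairwise (fun a b => index b s < index a s) (map snd c).
      by rewrite pairwise_map; apply: sub_pairwise pc => u v /andP [].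
    elim: (map snd c) => //= a l IH /andP [al pl].
    rewrite rev_cons -cats1 pairwise_cat IH // andbT.
    by apply/allrelP => x y; rewrite mem_rev inE => /(allP al) ? /eqP ->.
case: s us Cs {nest le le_tr pc} c mc sub => [|x t] us Cs c mc sub.
  by exists [::]; split=> // [u /Cs []|e]; rewrite ?inE.
have [q [uq _ cq wq]] := zigzag_path us sub; exists (x :: q); split=> // [u|e /wq [|[u]]].
- by rewrite -mc; apply: cq.
- by left.
- by rewrite mc => uC ->; right; exists u.
Qed.

(** * Posa rotations of a longest path *)

(** A step adds the edge from the head [x] to [y], drops the edge entering [y], and so reverses the
    prefix before [y]; the last vertex never moves. *)
Inductive rotation {n} (G : {set {set 'I_n}}) (s : seq 'I_n) : seq 'I_n -> Prop :=
| rotation_refl : rotation G s s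
| rotation_step x l y r : rotation G s (x :: l ++ y :: r) -> [set x; y] \in G ->
    rotation G s (rev (x :: l) ++ y :: r).

Definition rotation_heads {n} (G : {set {set 'I_n}}) (s : seq 'I_n) : {set 'I_n} :=
  [set x | `[< exists l, rotation G s (x :: l) >]].

Definition path_nbrs {n} (s : seq 'I_n) (S : {set 'I_n}) : {set 'I_n} :=
  [set y | [exists z in S, [set z; y] \in walk_edges s]].

Lemma walk_edges_rotate {n} (x : 'I_n) l y r :
  walk_edges (rev (x :: l) ++ y :: r) \subset [set x; y] |: walk_edges (x :: l ++ y :: r).
Proof.
rewrite walk_edges_cat -rev_cons walk_edges_rev walk_edges_cons2 setUC [[set y; x]]setUC.
rewrite -cat_cons; apply/subUsetP; split.
  by apply: subset_trans (subsetUr _ _); apply: walk_edges_catr.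
by apply: setUS; apply: walk_edges_catl.
Qed.

Lemma rotation_path {n} (G : {set {set 'I_n}}) s t :
  uniq s -> walk_edges s \subset G -> rotation G s t ->
  [/\ perm_eq t s, uniq t & walk_edges t \subset G].
Proof.
move=> us ws; elim=> [|x l y r _ [pt ut wt] xyG]; first by split.
have pt' : perm_eq (rev (x :: l) ++ y :: r) s.
  by apply: perm_trans pt; rewrite -cat_cons perm_cat2r perm_rev.
split=> //; first by rewrite (perm_uniq pt').
by apply: subset_trans (walk_edges_rotate _ _ _ _) _; rewrite subUset sub1set xyG.
Qed.

Lemma rotation_last_head {n} (G : {set {set 'I_n}}) s x l y r :
  rotation G s (x :: l ++ y :: r) -> [set x; y] \in G ->
  last x l \in rotation_heads G s.
Proof.
move=> rot /(rotation_step rot); rewrite inE => rot'; apply/asboolP.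
by move: rot'; rewrite lastI rev_rcons cat_cons; eexists; eassumption.
Qed.

Lemma last_walk_edge {n} (x : 'I_n) l y r :
  [set last x l; y] \in walk_edges (x :: l ++ y :: r).
Proof.
by apply/walk_edgesP; exists (belast x l), (last x l), y, r; rewrite -cat_cons lastI cat_rcons.
Qed.

(** The only new edge of a rotation joins [x] to [w]. Here [x] is a head, and [w] was preceded by
    [last x l], which becomes a head; if [w] were [y], that old edge would by induction lie on [s]
    and make [y] a path neighbour of a head. *)
Lemma rotation_keeps_nbrs {n} (G : {set {set 'I_n}}) s t y z :
  y \notin rotation_heads G s :|: path_nbrs s (rotation_heads G s) ->
  rotation G s t -> [set z; y] \in walk_edges t -> [set z; y] \in walk_edges s.
Proof.
rewrite in_setU negb_or => /andP [yS yN] rot; elim: rot z => // x l w r rot IH xwG z.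
move/(subsetP (walk_edges_rotate _ _ _ _)); rewrite in_setU1 => /orP [/eqP e|]; last exact: IH.
have : y \in [set x; w] by rewrite -e set22.
case/set2P=> E.
  by case/negP: yS; rewrite E inE; apply/asboolP; eexists; exact: rot.
case/negP: yN; rewrite inE; apply/existsP; exists (last x l).
rewrite (rotation_last_head rot xwG) /= IH // E; exact: last_walk_edge.
Qed.

(** Posa's lemma. A neighbour [y] off the rotated path would prolong it beyond the maximum. If [y]
    is on it, rotating along [x y] makes the predecessor of [y] a head; were [y] outside the union,
    the edge to that predecessor would come from [s], making [y] a path neighbour after all. *)
Lemma longest_path_nbrs {n} (G : {set {set 'I_n}}) (U : {set 'I_n}) s x y :
  uniq s -> walk_edges s \subset G -> {subset s <= U} ->
  (forall t, uniq t -> walk_edges t \subset G -> {subset t <= U} -> size t <= size s) ->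
  x \in rotation_heads G s -> [set x; y] \in G -> x != y -> y \in U ->
  y \in rotation_heads G s :|: path_nbrs s (rotation_heads G s).
Proof.
move=> us ws sU smax; rewrite {1}inE => /asboolP [t rot] xyG nxy yU.
have [pt ut wt] := rotation_path us ws rot.
have yt : y \in x :: t.
  apply: contraT => yt.
  have wyt : walk_edges [:: y, x & t] \subset G.
    by rewrite walk_edges_cons2 subUset sub1set setUC xyG wt.
  have uyt : uniq [:: y, x & t] by rewrite cons_uniq yt.
  suff /(smax _ uyt wyt) : {subset [:: y, x & t] <= U} by rewrite -(perm_size pt) /= ltnn.
  by move=> z; rewrite in_cons => /orP [/eqP ->//|]; rewrite (perm_mem pt) => /sU.
move: yt; rewrite in_cons eq_sym (negPf nxy) /= => yt.
case/splitPr: yt rot {pt ut wt} => l r rot.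
apply: contraT => yN.
have := rotation_keeps_nbrs yN rot (last_walk_edge x l y r).
move: yN; rewrite in_setU negb_or => /andP [_ /negP yN] e; case: yN.
by rewrite inE; apply/existsP; exists (last x l); rewrite (rotation_last_head rot xyG).
Qed.

Lemma path_nbrs_next_prev {n} (s : seq 'I_n) a b : uniq s ->
  [set a; b] \in walk_edges s ->
  b = nth a s (index a s).+1 \/ b = nth a s (index a s).-1.
Proof.
move=> us /(walk_edges_index us) [_ bs /orP [/eqP e|/eqP ->]].
  by left; rewrite -e nth_index.
by right; rewrite nth_index.
Qed.

Lemma card_path_nbrs {n} (s : seq 'I_n) (S : {set 'I_n}) :
  uniq s -> #|path_nbrs s S| <= 2 * #|S|.
Proof.
(* At an end of [s] the missing neighbour defaults to [z] itself; such values only enlarge the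
   covering set. *)
move=> us; pose f z := nth z s (index z s).+1; pose g z := nth z s (index z s).-1.
suff /subset_leq_card le : path_nbrs s S \subset [set f z | z in S] :|: [set g z | z in S].
  apply: leq_trans le _; apply: leq_trans (leq_card_setU _ _) _.
  by rewrite mul2n -addnn leq_add // leq_imset_card.
apply/subsetP => y; rewrite inE => /existsP [z /andP [zS /(path_nbrs_next_prev us) zy]].
by rewrite inE; case: zy => ->; rewrite imset_f ?orbT.
Qed.

(** Each edge is charged to an end in [S] together with a direction along [s], successor or
    predecessor. *)
Lemma card_walk_edges_meeting {n} (s : seq 'I_n) (S : {set 'I_n}) :
  uniq s -> #|[set e in walk_edges s | e :&: S != set0]| <= 2 * #|S|.
Proof.
move=> us; pose f z := [set z; nth z s (index z s).+1].
pose g z := [set z; nth z s (index z s).-1].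
suff /subset_leq_card le :
    [set e in walk_edges s | e :&: S != set0] \subset [set f z | z in S] :|: [set g z | z in S].
  apply: leq_trans le _; apply: leq_trans (leq_card_setU _ _) _.
  by rewrite mul2n -addnn leq_add // leq_imset_card.
have fg z y : z \in S -> [set z; y] \in walk_edges s ->
    [set z; y] \in [set f z | z in S] :|: [set g z | z in S].
  move=> zS /(path_nbrs_next_prev us) zy; rewrite inE.
  by apply/orP; case: zy => ->; [left|right]; apply/imsetP; exists z.
apply/subsetP => e; rewrite inE => /andP [ew /set0Pn [z /setIP [ze zS]]].
have /walk_edgesP [l [a [b [r [_ eab]]]]] := ew.
move: ew ze; rewrite eab => ew /set2P [] E; rewrite E in zS; first exact: fg.
by rewrite setUC; apply: fg; rewrite // setUC.
Qed.

(** * Ranks along the path and classes of chords *)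

(** Ranks within [T] replace positions along [s] because they stay below [#|T|]: the number of
    weighted sums, hence of paths, is then linear in [#|T|], whatever the length of [s]. *)
Definition path_rank {n} (s : seq 'I_n) (T : {set 'I_n}) (a : 'I_n) : nat :=
  #|[set u in T | index u s < index a s]|.

Lemma path_rank_lt {n} (s : seq 'I_n) (T : {set 'I_n}) a b :
  a \in T -> index a s < index b s -> path_rank s T a < path_rank s T b.
Proof.
move=> aT ab; apply: proper_card; apply/properP; split.
  by apply/subsetP => u; rewrite !inE => /andP [-> /ltn_trans]; apply.
by exists a; rewrite !inE ?aT ?ab // ltnn andbF.
Qed.

Lemma path_rank_card {n} (s : seq 'I_n) (T : {set 'I_n}) a :
  a \in T -> path_rank s T a < #|T|.
Proof.
move=> aT; apply: proper_card; apply/properP; split.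
  by apply/subsetP => u; rewrite !inE => /andP [].
by exists a; rewrite // inE ltnn andbF.
Qed.

Lemma rank_sum_bound w i j m : i < m -> j < m -> i + w * j < w.+1 * m.
Proof. by move=> im jm; rewrite mulSn -addSn leq_add // leq_mul2l ltnW ?orbT. Qed.

(** The weights 1 and 2 give a linear system of determinant 1, so one class of each weight pins down
    both ends of a chord. *)
Lemma rank_sums_inj i j i' j' :
  i + 1 * j = i' + 1 * j' -> i + 2 * j = i' + 2 * j' -> i = i' /\ j = j'.
Proof. lia. Qed.

Lemma index_inj {n} (s : seq 'I_n) : {in s &, injective (index^~ s)}.
Proof. by move=> a b sa sb /(congr1 (nth a s)); rewrite !nth_index. Qed.

(* Inside a class [rank a + w * rank b = k] the left ends of the chords move right
   exactly when the right ends move left, so the class is nested. *)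
Lemma chord_class_paths {n} (G D : {set {set 'I_n}}) (s : seq 'I_n) (T : {set 'I_n}) w :
  uniq s -> walk_edges s \subset G -> D \subset G -> [disjoint D & walk_edges s] ->
  {subset T <= s} -> (forall e, e \in D -> e \subset T) -> 0 < w ->
  exists f : nat -> {set {set 'I_n}}, forall k,
    [/\ is_path_in G (f k), f k \subset D :|: walk_edges s &
     forall a b, [set a; b] \in D -> index a s < index b s ->
       ([set a; b] \in f k) = (path_rank s T a + w * path_rank s T b == k)].
Proof.
move=> us wG DG dis Ts DT w0.
suff /choice [f fP] : forall k, exists F : {set {set 'I_n}},
    [/\ is_path_in G F, F \subset D :|: walk_edges s &
     forall a b, [set a; b] \in D -> index a s < index b s ->
       ([set a; b] \in F) = (path_rank s T a + w * path_rank s T b == k)].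
  by exists f.
move=> k; pose rk := path_rank s T.
pose C := [set u : 'I_n * 'I_n | [&& [set u.1; u.2] \in D, index u.1 s < index u.2 s &
                                   rk u.1 + w * rk u.2 == k]].
have CT u : u \in C -> u.1 \in T /\ u.2 \in T.
  rewrite inE => /andP [/DT/subsetP uT _].
  by split; apply: uT; rewrite ?set21 ?set22.
have [||q [uq Cq qC]] := nested_chords_path (s := s) (C := C) us.
- by move=> u uC; have [u1 u2] := CT u uC; move: uC; rewrite inE => /and3P [_ lu _]; split; auto.
- move=> u v uC vC nuv le; have [u1 u2] := CT u uC; have [v1 v2] := CT v vC.
  move: uC vC; rewrite !inE => /and3P [_ _ /eqP ek] /and3P [_ _ /eqP]; rewrite -ek => e.
  have lt2 : rk v.2 < rk u.2 -> index v.2 s < index u.2 s.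
    rewrite ltnNge; apply: contraNltn; rewrite leq_eqVlt => /orP [/eqP|].
      by move/(index_inj (Ts _ u2) (Ts _ v2)) => ->.
    by move/(path_rank_lt u2)/ltnW.
  (* Chords of one class with the same left end have equal right ranks, as [w] is positive, and so
     coincide. *)
  have [eq1|ne1] := eqVneq (index u.1 s) (index v.1 s).
    have e1 : u.1 = v.1 by apply: index_inj eq1; apply: Ts.
    have e2 : u.2 = v.2.
      move: e; rewrite e1 => /addnI /eqP; rewrite eqn_pmul2l // => /eqP e.
      apply: (index_inj (Ts _ u2) (Ts _ v2)).
      have [/(path_rank_lt u2)|/(path_rank_lt v2)|//] := ltngtP (index u.2 s) (index v.2 s).
        by rewrite -!/(rk _) e ltnn.
      by rewrite -!/(rk _) e ltnn.
    by case: u v e1 e2 nuv {u1 u2 v1 v2 lt2 e ek le eq1} => [? ?] [? ?] /= -> ->; rewrite eqxx.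
  have lt1 : index u.1 s < index v.1 s by rewrite ltn_neqAle ne1.
  have r1 : rk u.1 < rk v.1 := path_rank_lt u1 lt1.
  split=> //; apply: lt2; rewrite -(ltn_pmul2l w0).
  move: (rk u.1) (rk v.1) (w * rk u.2) (w * rk v.2) e r1; lia.
exists (walk_edges q); split.
- exists q; split=> //; apply/subsetP => e /qC [/(subsetP wG)//|[u]].
  by rewrite inE => /and3P [/(subsetP DG) + _ _] ->.
- apply/subsetP => e /qC; rewrite in_setU => -[->|[u]]; first exact: orbT.
  by rewrite inE => /and3P [uD _ _] ->; rewrite uD.
(* An edge of [D] on [q] is not an edge of [s], so it is a chord of [C]; both are written with the
   smaller index first, so their ends match in order. *)
move=> a b abD lab; apply/idP/eqP => [/qC [abw|[u]]|abk].
- by have := disjointFr dis abD; rewrite abw.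
- rewrite inE => /and3P [_ lu /eqP <-] /setP e.
  have := e u.1; have := e u.2; rewrite !inE !eqxx orbT /=.
  case/orP=> /eqP E2 /orP [] /eqP E1; move: lu; rewrite E1 E2 ?ltnn //.
  by move/(ltn_trans lab); rewrite ltnn.
- have /Cq : (a, b) \in C by rewrite inE /= abD lab; apply/eqP.
  by [].
Qed.

(** * Induction on the set of remaining vertices *)

Lemma longest_path {n} (G : {set {set 'I_n}}) (U : {set 'I_n}) : U != set0 ->
  exists x s, [/\ uniq (x :: s), walk_edges (x :: s) \subset G, {subset x :: s <= U} &
    forall t, uniq t -> walk_edges t \subset G -> {subset t <= U} -> size t <= size (x :: s)].
Proof.
case/set0Pn=> x xU.
pose Q k := `[< exists t, [/\ uniq t, walk_edges t \subset G, {subset t <= U} & size t = k] >].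
have Q1 : Q 1.
  apply/asboolP; exists [:: x]; split=> //.
    by apply/subsetP => e; rewrite inE.
  by move=> y; rewrite inE => /eqP ->.
have Qn k : Q k -> k <= n.
  move=> /asboolP [t [ut _ _ <-]].
  by rewrite -(card_uniqP ut) -[n in _ <= n]card_ord max_card.
case: (ex_maxnP (ex_intro _ 1 Q1) Qn) => k /asboolP [[|y s] [us ws sU <-]] smax.
  by have := smax _ Q1.
exists y, s; split=> // t ut wt tU; apply: smax; apply/asboolP; by exists t.
Qed.

Lemma single_edge_path {n} (G : {set {set 'I_n}}) e :
  is_graph G -> e \in G -> is_path_in G [set e].
Proof.
move=> /subsetP gG eG; have := gG e eG; rewrite inE => /cards2P [a [b [nab eab]]].
exists [:: a; b]; split; rewrite ?sub1set //=.
  by rewrite inE nab.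
by apply/setP => f; rewrite eab !inE.
Qed.

Lemma card_imset_ord (T : finType) (f : nat -> T) k : #|[set f i | i : 'I_k]| <= k.
Proof. by apply: leq_trans (leq_imset_card _ _) _; rewrite card_ord. Qed.

(** [U] holds the vertices not yet deleted, which lets the induction shrink the graph without
    changing its vertex type. *)
Theorem graph_has_linear_sps {n} (U : {set 'I_n}) (G : {set {set 'I_n}}) :
  is_graph G -> (forall e, e \in G -> e \subset U) -> has_sps_of_size_le G (18 * #|U|).
Proof.
have [k] := ubnP #|U|; elim: k U G => // k IH U G ltk gG GU.
have [U0|U0] := eqVneq U set0.
  have G0 e : e \in G -> False.
    move=> eG; have := subsetP gG e eG; rewrite inE.
    by have := GU e eG; rewrite U0 subset0 => /eqP ->; rewrite cards0.
  exists set0; split; last by rewrite cards0.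
  by split=> [P|e e' /G0]; rewrite ?inE.
have [x [s [us ws sU smax]]] := longest_path G U0.
set P := x :: s in us ws sU smax; pose S := rotation_heads G P.
have SP : {subset S <= P}.
  move=> y; rewrite inE => /asboolP [t /(rotation_path us ws) [/perm_mem <- _ _]].
  exact: mem_head.
(* The trivial rotation puts [x] in [S]; that [S] is nonempty makes the induction decrease and later
   pays for the path [P] itself. *)
have xS : x \in S by rewrite inE; apply/asboolP; exists s; apply: rotation_refl.
have S1 : 0 < #|S| by apply/card_gt0P; exists x.
pose T := S :|: path_nbrs P S.
have TP : {subset T <= P}.
  move=> y /setUP [/SP//|]; rewrite inE => /existsP [z /andP [_ zy]].
  by case: (walk_edges_index us zy).
have cardT : #|T| <= 3 * #|S|.
  apply: leq_trans (leq_card_setU _ _) _.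
  by have := card_path_nbrs S us; lia.
pose meets e := e :&: S != set0 :> {set 'I_n}.
pose D := [set e in G | meets e] :\: walk_edges P.
have DG : D \subset G by apply/subsetP => e /setDP [/setIdP []].
have DT e : e \in D -> e \subset T.
  move=> /setDP [/setIdP [eG eS] _]; have := subsetP gG e eG.
  rewrite inE => /cards2P [a [b [nab eab]]].
  (* Whichever end of [e] lies in [S], the maximality of [P] confines the other end to [T]. *)
  have nbr y z : y \in S -> e = [set y; z] -> y != z -> e \subset T.
    move=> yS eyz nyz; rewrite eyz; apply/subsetP => u /set2P [] ->.
      by rewrite in_setU yS.
    apply: (longest_path_nbrs us ws sU smax yS) => //; first by rewrite -eyz.
    by apply: (subsetP (GU e eG)); rewrite eyz set22.
  move: eS => /set0Pn [y /setIP []]; rewrite {1}eab => /set2P [] -> yS.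
    exact: nbr nab.
  by apply: (nbr b a yS); rewrite 1?setUC 1?eq_sym.
have disD : [disjoint D & walk_edges P].
  by rewrite disjoints_subset; apply/subsetP => e; rewrite in_setC => /setDP [].
have [f1 f1P] := chord_class_paths us ws DG disD TP DT (w := 1) isT.
have [f2 f2P] := chord_class_paths us ws DG disD TP DT (w := 2) isT.
have cU : #|U :\: S| + #|S| = #|U|.
  have sSU : S \subset U by apply/subsetP => y /SP /sU.
  by rewrite cardsDS // subnK // subset_leq_card.
pose G' := [set e in G | ~~ meets e].
have [|||F' [[F'path F'sep] cF']] := IH (U :\: S) G'.
- by move: cU ltk S1; lia.
- by apply: subset_trans gG; apply/subsetP => e /setIdP [].
- move=> e /setIdP [/GU eU]; rewrite /meets negbK setI_eq0 => dis.
  by rewrite subsetD eU.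
pose E1 := [set [set e] | e in [set e in walk_edges P | meets e]].
pose E2 := [set f1 i | i : 'I_(2 * #|T|)].
pose E3 := [set f2 i | i : 'I_(3 * #|T|)].
exists (F' :|: (walk_edges P |: (E1 :|: (E2 :|: E3)))); split; last first.
  have c1 : #|E1| <= 2 * #|S|.
    by apply: leq_trans (leq_imset_card _ _) _; apply: card_walk_edges_meeting.
  have c2 : #|E2| <= 2 * #|T| by apply: card_imset_ord.
  have c3 : #|E3| <= 3 * #|T| by apply: card_imset_ord.
  apply: leq_trans (_ : _ <= #|F'| + (1 + (#|E1| + (#|E2| + #|E3|)))) _.
    apply: leq_trans (leq_card_setU _ _) _; rewrite leq_add2l.
    apply: leq_trans (leq_card_setU _ _) _; rewrite cards1 leq_add2l.
    by apply: leq_trans (leq_card_setU _ _) _; rewrite leq_add2l leq_card_setU.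
  (* The new paths number at most [1 + 2 * #|S| + 5 * #|T|], hence at most [1 + 17 * #|S|], which is
     at most [18 * #|S|]. *)
  move: cF' c1 c2 c3 cU cardT S1.
  move: #|F'| #|E1| #|E2| #|E3| #|U| #|U :\: S| #|T| #|S|; lia.
split.
  move=> Q; rewrite !in_setU in_set1 => /or4P [/F'path|/eqP ->|/imsetP [e]|].
  - move=> [t [ut -> wt]]; exists t; split=> //.
    by apply: subset_trans wt _; apply/subsetP => e /setIdP [].
  - by exists P.
  - by move=> /setIdP [ew _] ->; apply: single_edge_path => //; apply: (subsetP ws).
  - by case/orP=> /imsetP [i _ ->]; [case: (f1P i)|case: (f2P i)].
(* If neither edge meets [S], both survive in [G'] and [F'] separates them; by symmetry it remains
   to treat [e] meeting [S]. *)
suff sep e e' : e \in G -> e' \in G -> e != e' -> meets e ->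
    exists2 Q, Q \in F' :|: (walk_edges P |: (E1 :|: (E2 :|: E3))) &
      (e \in Q) != (e' \in Q).
  move=> e e' eG e'G nee'.
  have [em|em] := boolP (meets e); first exact: sep.
  have [e'm|e'm] := boolP (meets e').
    by have [|Q QF QE] := sep e' e e'G eG _ e'm; rewrite 1?eq_sym //; exists Q; rewrite // eq_sym.
  have [||//|Q QF QE] := F'sep e e'; rewrite ?inE ?eG ?e'G //.
  by exists Q; rewrite // in_setU QF.
move=> eG e'G nee' em.
have sepE1 u v : u != v -> u \in walk_edges P -> meets u ->
    exists2 Q, Q \in F' :|: (walk_edges P |: (E1 :|: (E2 :|: E3))) &
      (u \in Q) != (v \in Q).
  move=> nuv uw um; exists [set u].
    rewrite !in_setU in_set1 (_ : [set u] \in E1) ?orbT //.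
    by apply/imsetP; exists u => //; apply/setIdP.
  by rewrite !in_set1 eqxx [v == u]eq_sym (negPf nuv).
have [ew|ew] := boolP (e \in walk_edges P); first exact: sepE1.
have [e'w|e'w] := boolP (e' \in walk_edges P).
  by exists (walk_edges P); rewrite ?(negPf ew) ?e'w // !in_setU in_set1 eqxx orbT.
have eD : e \in D by rewrite in_setD ew; apply/setIdP.
pose rk := path_rank P T.
have ends u : u \in D -> exists a b, [/\ u = [set a; b], index a P < index b P, a \in T & b \in T].
  move=> uD; have := subsetP gG u (subsetP DG u uD); rewrite inE => /cards2P [a [b [nab uab]]].
  have /subsetP uT := DT _ uD.
  have aT : a \in T by apply: uT; rewrite uab set21.
  have bT : b \in T by apply: uT; rewrite uab set22.
  have [lab|lba|/(index_inj (TP _ aT) (TP _ bT)) E] := ltngtP (index a P) (index b P).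
  - by exists a, b.
  - by exists b, a; rewrite setUC.
  - by rewrite E eqxx in nab.
have [a [b [eab lab aT bT]]] := ends e eD.
have ra : rk a < #|T| by apply: path_rank_card.
have rb : rk b < #|T| by apply: path_rank_card.
have k1 : rk a + 1 * rk b < 2 * #|T|.
  exact: rank_sum_bound.
have k2 : rk a + 2 * rk b < 3 * #|T|.
  exact: rank_sum_bound.
pose A1 := f1 (Ordinal k1); pose A2 := f2 (Ordinal k2).
have A1F : A1 \in F' :|: (walk_edges P |: (E1 :|: (E2 :|: E3))).
  by rewrite !in_setU (_ : A1 \in E2) ?orbT //; apply/imsetP; exists (Ordinal k1).
have A2F : A2 \in F' :|: (walk_edges P |: (E1 :|: (E2 :|: E3))).
  by rewrite !in_setU (_ : A2 \in E3) ?orbT //; apply/imsetP; exists (Ordinal k2).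
have [_ A1s A1e] := f1P (Ordinal k1); have [_ _ A2e] := f2P (Ordinal k2).
have eA1 : e \in A1 by rewrite eab A1e -?eab.
have eA2 : e \in A2 by rewrite eab A2e -?eab.
(* All edges of [A1] lie in [D] or on [P], so [A1] misses [e'] when [e'] is in neither. *)
have [e'D|e'D] := boolP (e' \in D); last first.
  exists A1; rewrite // eA1; apply/negP => /eqP/esym /(subsetP A1s).
  by rewrite in_setU (negPf e'D) (negPf e'w).
have [c [d [ecd lcd cT dT]]] := ends e' e'D.
have [e'A1|e'A1] := boolP (e' \in A1); last by exists A1; rewrite // eA1.
(* If [A1] and [A2] both contain [e'], both weighted sums agree for the two edges, hence so do the
   ranks of their ends, which forces [e = e']. *)
exists A2; rewrite // eA2; apply/negP => /eqP/esym e'A2.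
have q1 : rk c + 1 * rk d = rk a + 1 * rk b by apply/eqP; rewrite -A1e -?ecd.
have q2 : rk c + 2 * rk d = rk a + 2 * rk b by apply/eqP; rewrite -A2e -?ecd.
have [rab rcd] : rk c = rk a /\ rk d = rk b.
  exact: rank_sums_inj q1 q2.
have rk_inj u v : u \in T -> v \in T -> rk u = rk v -> u = v.
  move=> uT vT euv; apply: (index_inj (TP _ uT) (TP _ vT)).
  have [/(path_rank_lt uT)|/(path_rank_lt vT)|//] := ltngtP (index u P) (index v P).
    by rewrite -!/(rk _) euv ltnn.
  by rewrite -!/(rk _) euv ltnn.
by move: nee'; rewrite eab ecd (rk_inj _ _ cT aT rab) (rk_inj _ _ dT bT rcd) eqxx.
Qed.

(** * From all graphs to the random graph *)

Local Open Scope ring_scope.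

(** Expanding the product of the factors [p + (1 - p)] over all pairs yields the sum of the weights
    of all graphs. *)
Lemma gnp_prob_total (R : realType) n (p : R) (Q : {set {set 'I_n}} -> Prop) :
  (forall G, is_graph G -> Q G) -> gnp_prob p Q = 1.
Proof.
(* The expansion runs over all sets of vertex subsets; the values 0 of [F] and 1 of [H] off
   [pairs n] kill the terms that are not graphs and leave the other weights unchanged. *)
move=> QT; pose F e : R := if e \in pairs n then p else 0.
pose H e : R := if e \in pairs n then 1 - p else 1.
have <- : \prod_(e : {set 'I_n}) (F e + H e) = 1.
  by apply: big1 => e _; rewrite /F /H; case: ifP => _; rewrite ?add0r // addrC subrK.
rewrite bigA_distr /gnp_prob [RHS](bigID (@is_graph n)) /=.
rewrite [X in _ = _ + X]big1 ?addr0; last first.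
  move=> G /subsetPn [e eG eN].
  by rewrite (bigD1 e) //= eG /F (negPf eN) mul0r.
apply: eq_big => [G|G /andP [gG _]].
  by case gG: (is_graph G) => /=; rewrite ?andbF ?andbT //; apply/asboolP/QT.
rewrite /gnp_weight [RHS](bigID (mem (pairs n))) /= [X in _ * X]big1 ?mulr1.
  by apply: eq_bigr => e ep; rewrite /F /H ep.
move=> e eN; rewrite /H (negPf eN) ifN //.
by apply: contra eN; apply: (subsetP gG).
Qed.

Theorem theorem1p4 (R : realType) (p : nat -> R) :
  (forall n, 0 <= p n <= 1) ->
  forall eps : R, 0 < eps ->
  exists N : nat, forall n : nat, (N <= n)%N ->
    1 - eps <= gnp_prob (p n) (fun G : {set {set 'I_n}} => has_sps_of_size_le G (48 * n)).
Proof.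
(* The event holds for every graph, so its probability is exactly 1 for each [n], and the threshold
   0 serves every [eps]. *)
move=> _ eps eps0; exists 0%N => n _; rewrite gnp_prob_total.
  by rewrite gerBl ltW.
(* Taking all vertices as [U] gives the bound [18 * n], which is within [48 * n]. *)
move=> G gG; have [|F [sepF cF]] := graph_has_linear_sps (U := setT) gG.
  by move=> e _; apply: subsetT.
exists F; split=> //; apply: leq_trans cF _.
by rewrite cardsT card_ord leq_mul2r orbT.
Qed.
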